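(* Let $0\ne T\in\mathcal{B}(X)$ have a non-zero left annihilator. ($\alpha$) Let $T=\begin{bmatrix}T_1&T_2\\ 0&0\end{bmatrix}$ in $X=\mathcal{K}\oplus\mathcal{L}$ be a local block representation of $T$, where $T$ is not an idempotent with range $\mathcal{K}$ (i.e. $T_1\ne I_{\mathcal{K}}$). For $B\in\mathcal{B}(\mathcal{L},\mathcal{K})$, $C\in\mathcal{B}(\mathcal{K},\mathcal{L})$, $D\in\mathcal{B}(\mathcal{L})$ put $$S=T_{B,C,D}=\begin{bmatrix}T_1-BC&T_2-BD\\ C&D\end{bmatrix},\quad U=T_1-BC,\quad V=T_2-BD,$$ and consider the equations (1) $(T_1-BC)^2+(T_2-BD)C=T_1-BC$; (2) $(T_1-BC)(T_2-BD)+(T_2-BD)D=T_2-BD$; (3) $C(T_1-BC)+DC=C$; (4) $C(T_2-BD)+D^2=D$; (5) $T_1(T_1-BC)+T_2C=T_1$; (6) $T_1(T_2-BD)+T_2D=T_2$; (1$'$) $VC=(I_{\mathcal{K}}-U)U$; (2$'$) $UV=V(I_{\mathcal{L}}-D)$; (3$'$) $CU=(I_{\mathcal{L}}-D)C$; (4$'$) $CV=D(I_{\mathcal{L}}-D)$; (5$'$) $T_2C=T_1(I_{\mathcal{K}}-U)$; (6$'$) $T_1V=T_2(I_{\mathcal{L}}-D)$. Then the following conditions on $(B,C,D)$ are equivalent: (i) $S$ is an idempotent; (ii) $S$ is an idempotent and $TS=T$; (iii)(a) (1)–(4) hold; (iii)(b) (1)–(6) hold; (iv)(a) (1$'$)–(4$'$)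 hold; (iv)(b) (1$'$)–(6$'$) hold. If there exist $B\in\mathcal{B}(\mathcal{L},\mathcal{K})$, $C\in\mathcal{B}(\mathcal{K},\mathcal{L})$, $D\in\mathcal{B}(\mathcal{L})$ satisfying any of these equivalent conditions, then $T$ is a product of two idempotents in $\mathcal{B}(X)$. ($\beta$) Conversely, if $T$ is a product of two idempotents in $\mathcal{B}(X)$, then there exist some decomposition $X=\mathcal{K}\oplus\mathcal{L}$, a topological sum, with $\mathcal{K}\supset\mathcal{R}(T)$, and $B\in\mathcal{B}(\mathcal{L},\mathcal{K})$, $C\in\mathcal{B}(\mathcal{K},\mathcal{L})$, $D\in\mathcal{B}(\mathcal{L})$ such that, for the block form $T=\begin{bmatrix}T_1&T_2\\ 0&0\end{bmatrix}$ in this decomposition, the equivalent conditions (i)–(iv) of ($\alpha$) hold.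
   Context: $X$ is a complex Banach space; $\mathcal{B}(X_1,X_2)$ denotes the bounded linear maps $X_1\to X_2$, $\mathcal{B}(X)=\mathcal{B}(X,X)$, and $\mathcal{R}(\cdot)$ denotes range. A non-zero left annihilator of $T$ is a non-zero $A\in\mathcal{B}(X)$ with $AT=0$. ''$X=\mathcal{K}\oplus\mathcal{L}$, a topological sum'' means $\mathcal{K},\mathcal{L}$ are closed subspaces, both different from $\{0\}$ and $X$, with $\mathcal{K}\cap\mathcal{L}=\{0\}$, $\mathcal{K}+\mathcal{L}=X$ and bounded associated projections. Operators are written in block form $\begin{bmatrix}A_1&A_2\\ A_3&A_4\end{bmatrix}$ with $A(k+l)=(A_1k+A_2l)+(A_3k+A_4l)$ for $k\in\mathcal{K}$, $l\in\mathcal{L}$. A local block representation of $T$ is its block form $\begin{bmatrix}T_1&T_2\\ 0&0\end{bmatrix}$ with respect to a topological sum $X=\mathcal{K}\oplus\mathcal{L}$ such that $\mathcal{K}$ contains the closure of $\mathcal{R}(T)$. *)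

(* Defs.v *)
From HB Require Import structures.
From mathcomp Require Import all_boot all_order all_algebra.
From mathcomp Require Import complex.
From mathcomp Require Import all_classical all_reals topology normedtype.

Set Implicit Arguments.
Unset Strict Implicit.
Unset Printing Implicit Defensive.

Import Order.TTheory GRing.Theory Num.Theory.
Import numFieldNormedType.Exports.

Local Open Scope classical_set_scope.
Local Open Scope ring_scope.

Reserved Notation "A \co B" (at level 40, left associativity).

(* The space B(X, Y): a subtype of the functions X -> Y, from which it inherits
   the pointwise vector space structure. *)
Section BoundedOperators.
Context {K : numFieldType}.
Implicit Types X Y Z : normedModType K.

Definition bounded_linear X Y : {pred X -> Y} :=
  [pred f | `[< linear f /\ exists M : K, forall x, `|f x| <= M * `|x| >]].

Lemma bounded_linear_subsemimod X Y : subsemimod_closed (@bounded_linear X Y).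
Proof.
split; first split.
- apply/asboolP; split=> [a u v|]; first by rewrite /= scaler0 addr0.
  by exists 0 => x /=; rewrite normr0 mul0r.
- move=> f g /asboolP[lf [M fM]] /asboolP[lg [N gN]]; apply/asboolP; split.
    by move=> a u v; rewrite !fctE lf lg scalerDr addrACA.
  exists (M + N) => x; rewrite fctE (le_trans (ler_normD _ _))//.
  by rewrite mulrDl lerD.
- move=> c f /asboolP[lf [M fM]]; apply/asboolP; split.
    by move=> a u v; rewrite !fctE lf scalerDr !scalerA mulrC.
  exists (`|c| * M) => x; rewrite !fctE normrZ -mulrA.
  by rewrite ler_wpM2l.
Qed.

Record bop X Y := Bop {
  bop_fun :> X -> Y ;
  _ : bop_fun \in @bounded_linear X Y }.

HB.instance Definition _ X Y := [isSub for @bop_fun X Y].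
HB.instance Definition _ X Y := [Choice of bop X Y by <:].
HB.instance Definition _ X Y :=
  GRing.SubChoice_isSubLmodule.Build K (X -> Y) (@bounded_linear X Y) (bop X Y)
    (@bounded_linear_subsemimod X Y).

Lemma bop_linear X Y (A : bop X Y) : linear A.
Proof. by case: A => f /= /asboolP[]. Qed.

HB.instance Definition _ X Y (A : bop X Y) :=
  GRing.isLinear.Build K X Y *:%R A (bop_linear A).

Lemma bop_bounded X Y (A : bop X Y) :
  exists M : K, forall x, `|A x| <= M * `|x|.
Proof. by case: A => f /= /asboolP[]. Qed.

Lemma bid_subproof X : idfun \in @bounded_linear X X.
Proof. by apply/asboolP; split=> //; exists 1 => x; rewrite mul1r. Qed.

Definition bid X : bop X X := Bop (bid_subproof X).

Lemma bcomp_subproof X Y Z (A : bop Y Z) (B : bop X Y) :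
  A \o B \in @bounded_linear X Z.
Proof.
apply/asboolP; split=> [a u v|]; first by rewrite /= !linearP.
have [M AM] := bop_bounded A; have [N BN] := bop_bounded B.
exists (`|M| * N) => x /=; rewrite -mulrA (le_trans (AM _))//.
have [->|nz] := eqVneq (B x) 0.
  by rewrite normr0 mulr0 mulr_ge0// (le_trans _ (BN x)).
have M0 : 0 <= M.
  by rewrite -(pmulr_lge0 M (x := `|B x|)) ?normr_gt0// (le_trans _ (AM _)).
by rewrite ger0_norm// ler_wpM2l.
Qed.

Definition bcomp X Y Z (A : bop Y Z) (B : bop X Y) : bop X Z :=
  Bop (bcomp_subproof A B).

Definition is_idempotent X (A : bop X X) : Prop := bcomp A A = A.

Definition has_nonzero_left_annihilator X (T : bop X X) : Prop :=
  exists A : bop X X, A <> 0 /\ bcomp A T = 0.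

Definition product_of_two_idempotents X (T : bop X X) : Prop :=
  exists P Q : bop X X,
    [/\ is_idempotent P, is_idempotent Q & T = bcomp P Q].

End BoundedOperators.

Notation "A \co B" := (bcomp A B) : ring_scope.

Section ClosedSubspaces.
Context {K : numFieldType} {X : normedModType K}.

Record csubspace := CSubspace {
  csubspace_set : set X ;
  csubspace_closed : closed csubspace_set ;
  csubspace_submod : submod_closed (mem csubspace_set) }.

Record csubspace_type (E : csubspace) := CSubspaceElt {
  csubspace_val :> X ;
  _ : csubspace_val \in mem (csubspace_set E) }.

Variable E : csubspace.

HB.instance Definition _ := [isSub for @csubspace_val E].
HB.instance Definition _ := [Choice of csubspace_type E by <:].
HB.instance Definition _ :=
  GRing.SubChoice_isSubLmodule.Build K X (mem (csubspace_set E))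
    (csubspace_type E) (GRing.submod_closed_semi (csubspace_submod E)).

Let norm (x : csubspace_type E) : K := `|val x|.

Let ler_normD x y : norm (x + y) <= norm x + norm y.
Proof. exact: Num.Theory.ler_normD. Qed.

Let normrZ a x : norm (a *: x) = `|a| * norm x.
Proof. by rewrite /norm -normrZ. Qed.

Let normr0_eq0 x : norm x = 0 -> x = 0.
Proof. by move=> /normr0_eq0 x0; apply: val_inj. Qed.

HB.instance Definition _ :=
  Lmodule_isNormed.Build K (csubspace_type E) ler_normD normrZ normr0_eq0.

Lemma bincl_subproof : @csubspace_val E \in @bounded_linear K (csubspace_type E) X.
Proof. by apply/asboolP; split=> //; exists 1 => x; rewrite mul1r. Qed.

Definition bincl : bop (csubspace_type E) X := Bop bincl_subproof.

End ClosedSubspaces.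

Arguments csubspace {K} X.
Coercion csubspace_type : csubspace >-> Sortclass.

Section TopologicalSums.
Context {K : numFieldType} {X : normedModType K}.

(* The associated projections are fields, but they are determined by the two
   summands; requiring them in bop says that they are bounded. *)
Record topsum := TopSum {
  summandK : csubspace X ;
  summandL : csubspace X ;
  summandK_neq0 : csubspace_set summandK <> [set 0] ;
  summandK_neqT : csubspace_set summandK <> setT ;
  summandL_neq0 : csubspace_set summandL <> [set 0] ;
  summandL_neqT : csubspace_set summandL <> setT ;
  topsumI : csubspace_set summandK `&` csubspace_set summandL = [set 0] ;
  topsumD : forall x : X, exists (k : summandK) (l : summandL),
    x = (k : X) + (l : X) ;
  projK : bop X summandK ;
  projL : bop X summandL ;
  projKE : forall (k : summandK) (l : summandL), projK ((k : X) + (l : X)) = k ;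
  projLE : forall (k : summandK) (l : summandL), projL ((k : X) + (l : X)) = l }.

Section Block.
Variable KL : topsum.
Local Notation KK := (summandK KL).
Local Notation LL := (summandL KL).

Definition block (A1 : bop KK KK) (A2 : bop LL KK)
    (A3 : bop KK LL) (A4 : bop LL LL) : bop X X :=
  bincl KK \co (A1 \co projK KL + A2 \co projL KL) +
  bincl LL \co (A3 \co projK KL + A4 \co projL KL).

Lemma blockE A1 A2 A3 A4 (k : KK) (l : LL) :
  block A1 A2 A3 A4 ((k : X) + (l : X)) =
  ((A1 k + A2 l : KK) : X) + ((A3 k + A4 l : LL) : X).
Proof.
rewrite -[LHS]/(((A1 (projK KL ((k : X) + (l : X))) + A2 (projL KL ((k : X) + (l : X))) : KK) : X) +
  ((A3 (projK KL ((k : X) + (l : X))) + A4 (projL KL ((k : X) + (l : X))) : LL) : X)).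
by rewrite projKE projLE.
Qed.

Definition local_block_rep (T : bop X X) (T1 : bop KK KK) (T2 : bop LL KK) :=
  closure (range T) `<=` csubspace_set KK /\ T = block T1 T2 0 0.

End Block.

End TopologicalSums.

Arguments topsum {K} X.
Arguments block {K X} KL A1 A2 A3 A4.

Section Conditions.
Context {K : numFieldType} {X : normedModType K} (KL : topsum X).
Local Notation KK := (summandK KL).
Local Notation LL := (summandL KL).
Local Notation IK := (bid KK).
Local Notation IL := (bid LL).
Variables (T1 : bop KK KK) (T2 : bop LL KK).
Variables (B : bop LL KK) (C : bop KK LL) (D : bop LL LL).

Definition opS : bop X X := block KL (T1 - B \co C) (T2 - B \co D) C D.

Definition eqs_1_4 : Prop :=
  [/\ (T1 - B \co C) \co (T1 - B \co C) + (T2 - B \co D) \co C = T1 - B \co C,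
      (T1 - B \co C) \co (T2 - B \co D) + (T2 - B \co D) \co D = T2 - B \co D,
      C \co (T1 - B \co C) + D \co C = C
    & C \co (T2 - B \co D) + D \co D = D].

Definition eqs_5_6 : Prop :=
  T1 \co (T1 - B \co C) + T2 \co C = T1 /\
  T1 \co (T2 - B \co D) + T2 \co D = T2.

Definition opU : bop KK KK := T1 - B \co C.
Definition opV : bop LL KK := T2 - B \co D.

Definition eqs_1'_4' : Prop :=
  [/\ opV \co C = (IK - opU) \co opU,
      opU \co opV = opV \co (IL - D),
      C \co opU = (IL - D) \co C
    & C \co opV = D \co (IL - D)].

Definition eqs_5'_6' : Prop :=
  T2 \co C = T1 \co (IK - opU) /\
  T1 \co opV = T2 \co (IL - D).

Definition cond_i : Prop := is_idempotent opS.
(* T is meant to be block KL T1 T2 0 0. *)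
Definition cond_ii (T : bop X X) : Prop := is_idempotent opS /\ T \co opS = T.
Definition cond_iiia : Prop := eqs_1_4.
Definition cond_iiib : Prop := eqs_1_4 /\ eqs_5_6.
Definition cond_iva : Prop := eqs_1'_4'.
Definition cond_ivb : Prop := eqs_1'_4' /\ eqs_5'_6'.

End Conditions.

(* Main.v *)
(* Let E = [I B; 0 0], an idempotent with range K.  Then E S = T for every
   choice of B, C, D, so S S = S implies T S = E S S = T, and T = E S is a product of
   two idempotents.  The remaining conditions express S S = S and T S = T
   blockwise.  Conversely, if T = P Q with idempotents P and Q, then in the
   decomposition X = R(P) + ker P the operator S for B = 0, with C and D the
   lower blocks of Q, is Q itself. *)

Require Import Defs.
From HB Require Import structures.
From mathcomp Require Import all_boot all_order all_algebra.
From mathcomp Require Import complex.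
From mathcomp Require Import all_classical all_reals topology normedtype.

Set Implicit Arguments.
Unset Strict Implicit.
Unset Printing Implicit Defensive.

Import Order.TTheory GRing.Theory Num.Theory.
Import numFieldNormedType.Exports.

Local Open Scope classical_set_scope.
Local Open Scope ring_scope.

(** * Algebra and continuity of bounded operators, kernels and corestrictions *)

Section BopTheory.
Context {K : numFieldType}.
Implicit Types X Y Z W : normedModType K.

Lemma bopP X Y (A B : bop X Y) : A =1 B -> A = B.
Proof. by move=> AB; apply: val_inj; apply/funext. Qed.

Lemma bopDE X Y (A B : bop X Y) x : (A + B) x = A x + B x.
Proof. by []. Qed.

Lemma bopNE X Y (A : bop X Y) x : (- A) x = - A x.
Proof. by []. Qed.

Lemma bop0E X Y x : (0 : bop X Y) x = 0.
Proof. by []. Qed.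

Lemma bcompE X Y Z (A : bop Y Z) (B : bop X Y) x : (A \co B) x = A (B x).
Proof. by []. Qed.

Lemma bcompA X Y Z W (A : bop Z W) (B : bop Y Z) (C : bop X Y) :
  A \co (B \co C) = A \co B \co C.
Proof. exact: bopP. Qed.

Lemma bcompBl X Y Z (A B : bop Y Z) (C : bop X Y) :
  (A - B) \co C = A \co C - B \co C.
Proof. exact: bopP. Qed.

Lemma bcompBr X Y Z (A : bop Y Z) (B C : bop X Y) :
  A \co (B - C) = A \co B - A \co C.
Proof. by apply: bopP => x; rewrite bcompE !bopDE !bopNE linearB. Qed.

Lemma bcomp1l X Y (A : bop X Y) : bid Y \co A = A.
Proof. exact: bopP. Qed.

Lemma bcomp1r X Y (A : bop X Y) : A \co bid X = A.
Proof. exact: bopP. Qed.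

Lemma bcomp0l X Y Z (A : bop X Y) : (0 : bop Y Z) \co A = 0.
Proof. exact: bopP. Qed.

Lemma bcomp0r X Y Z (A : bop Y Z) : A \co (0 : bop X Y) = 0.
Proof. by apply: bopP => x; rewrite bcompE !bop0E linear0. Qed.

Lemma bop_continuous X Y (A : bop X Y) : continuous A.
Proof.
apply: bounded_linear_continuous; apply/linear_boundedP.
have [M AM] := bop_bounded A.
(* The bound [M] is just some element of the scalar field, whereas the threshold has to be real,
   hence the absolute value. *)
exists `|M|; split => [|r Mr x]; first exact: normr_real.
(* The product of [M] with the norm of [x] dominates the norm of [A x], so it is nonnegative and
   equals its absolute value. *)
rewrite (le_trans _ (ler_wpM2r _ (ltW Mr)))// -[`|x|]normr_id -normrM.
by rewrite [in leRHS]ger0_norm// (le_trans _ (AM x)).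
Qed.

Section Kernel.
Context {X Y : normedModType K} (A : bop X Y).

Lemma bker_closed : closed (A @^-1` [set 0]).
Proof.
have /continuous_closedP := @bop_continuous X Y A; apply.
exact: accessible_closed_set1 (hausdorff_accessible (@norm_hausdorff _ _)) _.
Qed.

Lemma bker_submod : submod_closed (mem (A @^-1` [set 0])).
Proof.
split=> [|a u v]; rewrite !inE /= ?linear0// => Au Av.
by rewrite linearP /= Au Av scaler0 addr0.
Qed.

Definition bker : csubspace X := CSubspace bker_closed bker_submod.

End Kernel.

Section Corestriction.
Context {X Y : normedModType K} (E : csubspace Y) (A : bop X Y).
Hypothesis AE : forall x, A x \in mem (csubspace_set E).

Lemma bcorestr_subproof :
  (fun x => CSubspaceElt (AE x)) \in @bounded_linear K X E.
Proof.
apply/asboolP; split => [a u v|]; first by apply: val_inj; rewrite /= linearP.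
by have [M AM] := bop_bounded A; exists M.
Qed.

(** Serves to turn an idempotent and its complement into the projections onto the two summands. *)
Definition bcorestr : bop X E := Bop bcorestr_subproof.

End Corestriction.

End BopTheory.

(** * Calculus of block matrices over a topological sum *)

Section BlockTheory.
Context {K : numFieldType} {X : normedModType K} (KL : topsum X).
Local Notation KK := (summandK KL).
Local Notation LL := (summandL KL).

Lemma topsum_bopP (Y : normedModType K) (A B : bop X Y) :
  (forall (k : KK) (l : LL), A ((k : X) + (l : X)) = B ((k : X) + (l : X))) ->
  A = B.
Proof. by move=> AB; apply: bopP => x; have [k [l ->]] := topsumD KL x. Qed.

Lemma block_comp (A1 B1 : bop KK KK) (A2 B2 : bop LL KK) (A3 B3 : bop KK LL)
    (A4 B4 : bop LL LL) :
  block KL A1 A2 A3 A4 \co block KL B1 B2 B3 B4 =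
  block KL (A1 \co B1 + A2 \co B3) (A1 \co B2 + A2 \co B4)
           (A3 \co B1 + A4 \co B3) (A3 \co B2 + A4 \co B4).
Proof.
apply: topsum_bopP => k l; rewrite bcompE !blockE !bopDE !bcompE !linearD /=.
by congr (_ + _); rewrite addrACA.
Qed.

(** The projections separate the two rows; setting one of the arguments [k], [l] to zero then
    separates the columns. *)
Lemma block_inj (A1 B1 : bop KK KK) (A2 B2 : bop LL KK) (A3 B3 : bop KK LL)
    (A4 B4 : bop LL LL) :
  block KL A1 A2 A3 A4 = block KL B1 B2 B3 B4 ->
  [/\ A1 = B1, A2 = B2, A3 = B3 & A4 = B4].
Proof.
move=> AB.
have AB1 k l : A1 k + A2 l = B1 k + B2 l.
  have := congr1 (fun A : bop X X => Defs.projK KL (A ((k : X) + (l : X)))) AB.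
  by rewrite !blockE !projKE.
have AB2 k l : A3 k + A4 l = B3 k + B4 l.
  have := congr1 (fun A : bop X X => projL KL (A ((k : X) + (l : X)))) AB.
  by rewrite !blockE !projLE.
split; apply: bopP => x.
- by have := AB1 x 0; rewrite !linear0 !addr0.
- by have := AB1 0 x; rewrite !linear0 !add0r.
- by have := AB2 x 0; rewrite !linear0 !addr0.
- by have := AB2 0 x; rewrite !linear0 !add0r.
Qed.

Lemma blockP (A : bop X X) :
  A = block KL
    (Defs.projK KL \co A \co bincl KK) (Defs.projK KL \co A \co bincl LL)
    (projL KL \co A \co bincl KK) (projL KL \co A \co bincl LL).
Proof.
apply: topsum_bopP => k l; rewrite blockE !bcompE /=.
(* The value is split as [k' + l'], and the projections identify [k'] and [l'] with the two rows of
   the block form. *)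
have [k' [l' Akl]] := topsumD KL (A ((k : X) + (l : X))).
have pK := projKE k' l'; have pL := projLE k' l'.
rewrite -Akl !linearD /= in pK pL.
by rewrite Akl -pK -pL.
Qed.

End BlockTheory.

(** * Equivalence of the conditions on [B], [C], [D] *)

Section Equivalences.
Context {K : numFieldType} {X : normedModType K} (KL : topsum X).
Local Notation KK := (summandK KL).
Local Notation LL := (summandL KL).
Variables (T1 : bop KK KK) (T2 : bop LL KK).
Variables (B : bop LL KK) (C : bop KK LL) (D : bop LL LL).
Local Notation T := (block KL T1 T2 0 0).
Local Notation S := (opS T1 T2 B C D).

Lemma cond_iE : cond_i T1 T2 B C D <-> cond_iiia T1 T2 B C D.
Proof.
rewrite /cond_i /is_idempotent /opS block_comp.
by split => [/block_inj[]//|[-> -> -> ->]].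
Qed.

(** The lower rows of [T S] and of [T] both vanish, so only the two upper entries remain to be
    compared. *)
Lemma comp_opSE : T \co S = T <-> eqs_5_6 T1 T2 B C D.
Proof.
rewrite /opS block_comp !bcomp0l !addr0.
by split => [/block_inj[]//|[-> ->]].
Qed.

(* The idempotent with range K and kernel {l - B l | l in L}. *)
Definition oblique : bop X X := block KL (bid KK) B 0 0.

Lemma oblique_idempotent : is_idempotent oblique.
Proof.
by rewrite /is_idempotent block_comp !bcomp0l !bcomp0r !bcomp1l !addr0.
Qed.

(** [B] times the lower row of [S] cancels the terms [- B C] and [- B D] of its upper row. *)
Lemma oblique_opS : oblique \co S = T.
Proof. by rewrite block_comp !bcomp0l !bcomp1l !subrK !addr0. Qed.

Lemma opS_idempotent_comp : is_idempotent S -> T \co S = T.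
Proof. by move=> SS; rewrite -oblique_opS -bcompA SS. Qed.

Lemma eqs_1_4E : eqs_1_4 T1 T2 B C D <-> eqs_1'_4' T1 T2 B C D.
Proof.
rewrite /eqs_1_4 /eqs_1'_4' -/(opU T1 B C) -/(opV T2 B D).
(* [T1], [T2] and [B] enter only through [U] and [V]; for arbitrary [U], [V] each primed equation is
   the unprimed one with a term moved to the other side. *)
move: (opU T1 B C) (opV T2 B D) => U V.
rewrite !bcompBl !bcompBr !bcomp1l !bcomp1r.
split=> -[e1 e2 e3 e4]; split.
- by rewrite -[X in _ = X - _]e1 addrC addKr.
- by rewrite -[X in _ = X - _]e2 addrK.
- by rewrite -[X in _ = X - _]e3 addrK.
- by rewrite -[X in _ = X - _]e4 addrK.
- by rewrite e1 addrC subrK.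
- by rewrite e2 subrK.
- by rewrite e3 subrK.
- by rewrite e4 subrK.
Qed.

Lemma eqs_5_6E : eqs_5_6 T1 T2 B C D <-> eqs_5'_6' T1 T2 B C D.
Proof.
rewrite /eqs_5_6 /eqs_5'_6' -/(opU T1 B C) -/(opV T2 B D).
move: (opU T1 B C) (opV T2 B D) => U V.
rewrite !bcompBr !bcomp1r.
split=> -[e5 e6]; split.
- by rewrite -[X in _ = X - _]e5 addrC addKr.
- by rewrite -[X in _ = X - _]e6 addrK.
- by rewrite e5 addrC subrK.
- by rewrite e6 subrK.
Qed.

(** Proved as one cycle in the order listed. Wherever the last two equations have to be added, the
    proof passes through idempotence of [S], which gives [T S = T]. *)
Lemma conditions_equiv :
  [<-> cond_i T1 T2 B C D;
       cond_ii T1 T2 B C D T;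
       cond_iiia T1 T2 B C D;
       cond_iiib T1 T2 B C D;
       cond_iva T1 T2 B C D;
       cond_ivb T1 T2 B C D].
Proof.
tfae.
- by move=> SS; split=> //; exact: opS_idempotent_comp.
- by move=> [/cond_iE].
- move=> h; split=> //; apply/comp_opSE/opS_idempotent_comp.
  exact/cond_iE.
- by move=> [/eqs_1_4E].
- move=> h; split=> //; apply/eqs_5_6E/comp_opSE/opS_idempotent_comp.
  exact/cond_iE/eqs_1_4E.
- by move=> [/eqs_1_4E/cond_iE].
Qed.

End Equivalences.

(** * The topological sum given by a nontrivial idempotent *)

Section IdempotentSum.
Context {K : numFieldType} {X : normedModType K} (P : bop X X).
Hypothesis PP : is_idempotent P.
Hypotheses (P_neq0 : P <> 0) (P_neq1 : P <> bid X).

Let PK x : P (P x) = P x. Proof. by rewrite -bcompE PP. Qed.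

(** The range of [P], written as the kernel of [I - P] so that it is closed by continuity. *)
Let RK := bker (bid X - P).
Let RL := bker P.

Let RKE x : csubspace_set RK x <-> P x = x.
Proof.
split => [/subr0_eq//|xx].
by apply/eqP; rewrite [_ == _]subr_eq0; apply/eqP/esym.
Qed.

Let rangeK x : P x \in mem (csubspace_set RK).
Proof. by rewrite inE; apply/RKE. Qed.

Let rangeL x : (bid X - P) x \in mem (csubspace_set RL).
Proof.
by rewrite inE; apply: etrans (linearB P x (P x)) _; rewrite /= PK subrr.
Qed.

Lemma range_idempotentE : csubspace_set RK = range P.
Proof.
apply/seteqP; split => [x /RKE xx|_ [x _ <-]]; first by exists x.
exact/RKE.
Qed.

Let valK (k : RK) : P (k : X) = k.
Proof. by apply/RKE; move: (valP k); rewrite inE. Qed.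

Let valL (l : RL) : P (l : X) = 0.
Proof. by move: (valP l); rewrite inE. Qed.

(** The second clause lets [P] be read as the block matrix with the identity in the upper left
    corner and zeros elsewhere. *)
Lemma idempotent_topsum :
  exists KL : topsum X,
    csubspace_set (summandK KL) = range P /\
    P = bincl (summandK KL) \co Defs.projK KL.
Proof.
(* A zero range or a full kernel would force [P = 0]; a full range or a zero kernel would force
   [P = I]. *)
have K0 : csubspace_set RK <> [set 0].
  move=> K0; apply: P_neq0; apply: bopP => x.
  by have := rangeK x; rewrite inE K0.
have KT : csubspace_set RK <> setT.
  by move=> KT; apply: P_neq1; apply: bopP => x; apply/RKE; rewrite KT.
have L0 : csubspace_set RL <> [set 0].
  move=> L0; apply: P_neq1; apply: bopP => x; apply/eqP; rewrite eq_sym.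
  by have := rangeL x; rewrite inE L0 => /subr0_eq ->.
have LT : csubspace_set RL <> setT.
  move=> LT; apply: P_neq0; apply: bopP => x.
  by have : csubspace_set RL x by rewrite LT.
have KIL : csubspace_set RK `&` csubspace_set RL = [set 0].
  apply/seteqP; split => [x [/RKE xx x0]|_ ->]; first by rewrite /= -xx x0.
  by split; [apply/RKE; exact: linear0 | exact: linear0].
have KDL x : exists (k : RK) (l : RL), x = (k : X) + (l : X).
  exists (bcorestr rangeK x), (bcorestr rangeL x).
  exact/esym/(etrans (addrC _ _) (subrK (P x) x)).
have pK (k : RK) (l : RL) : bcorestr rangeK ((k : X) + (l : X)) = k.
  by apply: val_inj; rewrite /= linearD /= valK valL addr0.
have pL (k : RK) (l : RL) : bcorestr rangeL ((k : X) + (l : X)) = l.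
  apply: val_inj; rewrite -[LHS]/((k : X) + (l : X) - P ((k : X) + (l : X))).
  by rewrite linearD /= valK valL addr0 addrC addKr.
exists (TopSum K0 KT L0 LT KIL KDL pK pL).
split; first exact: range_idempotentE.
exact: bopP.
Qed.

End IdempotentSum.

(* If P = 1, then T = Q is idempotent and T = T T; a non-zero left annihilator
   excludes T = 1. *)
Lemma product_idempotents_neq1 (K : numFieldType) (X : normedModType K)
    (T : bop X X) :
  has_nonzero_left_annihilator T -> product_of_two_idempotents T ->
  exists P Q : bop X X,
    [/\ is_idempotent P, is_idempotent Q, P <> bid X & T = P \co Q].
Proof.
move=> [A [A0 AT]] [P [Q [PP QQ TPQ]]].
have [P1|P1] := pselect (P = bid X); last by exists P, Q.
have TQ : T = Q by rewrite TPQ P1 bcomp1l.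
exists Q, Q; split=> //; last by rewrite QQ.
move=> Q1; apply: A0.
by rewrite -[A]bcomp1r -Q1 -TQ.
Qed.

Theorem theorem4p5 (R : realType) (X : completeNormedModType R[i])
    (T : bop X X) (T_neq0 : T <> 0) (T_ann : has_nonzero_left_annihilator T) :
  (forall (KL : topsum X)
      (T1 : bop (summandK KL) (summandK KL))
      (T2 : bop (summandL KL) (summandK KL)),
    local_block_rep T T1 T2 ->
    ~ (is_idempotent T /\ range T = csubspace_set (summandK KL)) ->
    (forall (B : bop (summandL KL) (summandK KL))
        (C : bop (summandK KL) (summandL KL))
        (D : bop (summandL KL) (summandL KL)),
      [<-> cond_i T1 T2 B C D;
           cond_ii T1 T2 B C D T;
           cond_iiia T1 T2 B C D;
           cond_iiib T1 T2 B C D;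
           cond_iva T1 T2 B C D;
           cond_ivb T1 T2 B C D]) /\
    ((exists (B : bop (summandL KL) (summandK KL))
         (C : bop (summandK KL) (summandL KL))
         (D : bop (summandL KL) (summandL KL)),
       cond_i T1 T2 B C D \/ cond_ii T1 T2 B C D T \/
       cond_iiia T1 T2 B C D \/ cond_iiib T1 T2 B C D \/
       cond_iva T1 T2 B C D \/ cond_ivb T1 T2 B C D) ->
     product_of_two_idempotents T))
  /\
  (product_of_two_idempotents T ->
   exists (KL : topsum X)
     (T1 : bop (summandK KL) (summandK KL))
     (T2 : bop (summandL KL) (summandK KL))
     (B : bop (summandL KL) (summandK KL))
     (C : bop (summandK KL) (summandL KL))
     (D : bop (summandL KL) (summandL KL)),
     [/\ range T `<=` csubspace_set (summandK KL),
         T = block KL T1 T2 0 0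
       & cond_i T1 T2 B C D /\ cond_ii T1 T2 B C D T /\
         cond_iiia T1 T2 B C D /\ cond_iiib T1 T2 B C D /\
         cond_iva T1 T2 B C D /\ cond_ivb T1 T2 B C D]).
Proof.
split.
  move=> KL T1 T2 [_ TE] _; split=> [B C D|[B [C [D h]]]].
    by rewrite TE; exact: conditions_equiv.
  have eqv := conditions_equiv T1 T2 B C D.
  (* Whichever condition is given, the cycle leads back to idempotence of [S]. *)
  have SS : cond_i T1 T2 B C D.
    move: h; rewrite TE => -[//|[h|[h|[h|[h|h]]]]].
    - exact: (all_iffLR eqv 1 0 h).
    - exact: (all_iffLR eqv 2 0 h).
    - exact: (all_iffLR eqv 3 0 h).
    - exact: (all_iffLR eqv 4 0 h).
    - exact: (all_iffLR eqv 5 0 h).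
  exists (oblique B), (opS T1 T2 B C D); split=> //.
    exact: oblique_idempotent.
  by rewrite oblique_opS.
(* The factorization is chosen with [P] different from [I]; together with [P] nonzero this makes
   both summands proper and nonzero. *)
move=> /(product_idempotents_neq1 T_ann)[P [Q [PP QQ P1 TPQ]]].
have P0 : P <> 0 by move=> P0; apply: T_neq0; rewrite TPQ P0 bcomp0l.
have [KL [rangeP PE]] := idempotent_topsum PP P0 P1.
have QE := blockP KL Q.
(* The four entries of [Q] are named in turn. Left multiplication by [P] keeps the upper row and
   kills the lower one, so the upper entries of [Q] are those of [T]. *)
set T1 := Defs.projK KL \co Q \co bincl _ in QE.
set T2 := Defs.projK KL \co Q \co bincl _ in QE.
set C := projL KL \co Q \co bincl _ in QE.
set D := projL KL \co Q \co bincl _ in QE.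
have TE : T = block KL T1 T2 0 0.
  have -> : T = block KL (bid _) 0 0 0 \co Q.
    rewrite TPQ; congr (_ \co _).
    apply: (topsum_bopP (KL := KL)) => k l.
    by rewrite blockE PE bcompE projKE !bop0E !addr0.
  by rewrite QE block_comp !bcomp1l !bcomp0l !addr0.
have SS : cond_i T1 T2 0 C D.
  by rewrite /cond_i /opS !bcomp0l !subr0 -QE.
have eqv := conditions_equiv T1 T2 0 C D.
exists KL, T1, T2, 0, C, D; split=> //.
  (* The first summand is the range of [P], which contains every [P (Q x)]. *)
  by rewrite rangeP TPQ => _ [x _ <-]; exists (Q x).
rewrite TE; split; first exact: SS.
split; first exact: (all_iffLR eqv 0 1 SS).
split; first exact: (all_iffLR eqv 0 2 SS).
split; first exact: (all_iffLR eqv 0 3 SS).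
split; first exact: (all_iffLR eqv 0 4 SS).
exact: (all_iffLR eqv 0 5 SS).
Qed.
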